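(* There exist absolute constants $\varepsilon_0\in(0,1)$ and $C\ge1$ such that the following holds. Let $0<\varepsilon\le\varepsilon_0$ and $r>0$, and let $E\subset\mathbb{R}^2$ be the union of the horizontal axis $l_0$ and a line $l$ parallel to it at distance $\varepsilon r$. Then for every $q\in[1,\infty)$ and every $x\in E$, $$C^{-1}\varepsilon\le\beta_{2q,\mathcal{V}_1}(B_r(x)\cap E)\le C\varepsilon\qquad\text{and}\qquad \iota_{q,\mathcal{V}_1}(B_r(x)\cap E)\ge C^{-1}\log(\varepsilon^{-1})^{1/q}\,\varepsilon^2 .$$
   Context: $\mathcal{V}_1$ is the family of all affine lines in $\mathbb{R}^2$, $\pi_V$ is the orthogonal projection onto $V$, $B_r(x)$ is the open Euclidean ball, $\mathcal{H}^1$ is the one-dimensional Hausdorff measure and $\mu=\mathcal{H}^1|_E$. For $S=B_r(x)\cap E$ and $q\in[1,\infty)$, $$\beta_{q,\mathcal{V}_1}(S)=\inf_{V\in\mathcal{V}_1}\Big(\frac1{\mu(S)}\int_S\Big[\frac{\mathrm{dist}(y,V)}{\mathrm{diam}(S)}\Big]^qd\mu(y)\Big)^{1/q},$$ $$\iota_{q,\mathcal{V}_1}(S)=\inf_{V\in\mathcal{V}_1}\Big(\frac1{\mu(S)^2}\int_S\int_S\Big[\frac{\big||y-z|-|\pi_V(y)-\pi_V(z)|\big|}{\mathrm{diam}(S)}\Big]^qd\mu(y)d\mu(z)\Big)^{1/q}.$$ *)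

(* Defs.v *)
From HB Require Import structures.
From mathcomp Require Import all_boot all_order all_algebra.
From mathcomp Require Import all_classical all_reals all_analysis.
From mathcomp Require Import ring.

Set Implicit Arguments.
Unset Strict Implicit.
Unset Printing Implicit Defensive.

Import Order.TTheory GRing.Theory Num.Theory.
Import numFieldNormedType.Exports.

Local Open Scope classical_set_scope.
Local Open Scope ring_scope.

(* The canonical norm and balls of [R * R] are those of the sup norm, hence the
   Euclidean versions below. *)
Section euclidean_plane.
Context {R : realType}.
Implicit Types (x y z p v : R * R) (V W S : set (R * R)).

Definition dotp x y : R := x.1 * y.1 + x.2 * y.2.

Definition enorm x : R := Num.sqrt (dotp x x).

Definition eball x (r : R) : set (R * R) := [set y | enorm (y - x) < r].

(* The added 0 makes the diameter of the empty set equal to 0. *)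
Definition ediam S : \bar R :=
  ereal_sup (0%E |` [set (enorm (y - z))%:E | y in S & z in S]).

Definition diam S : R := fine (ediam S).

Definition dist_set y V : R := inf [set enorm (y - z) | z in V].

Definition set_dist V W : R := inf [set enorm (y - z) | y in V & z in W].

Definition line_through p v : set (R * R) := [set p + t *: v | t in [set: R]].

Definition affine_line : set (set (R * R)) :=
  [set V | exists p, exists2 v, v != 0 & V = line_through p v].

Definition parallel V W : Prop := exists w : R * R, W = [set w + y | y in V].

Definition orth_proj V y : R * R :=
  get [set p | V p /\ forall z, V z -> dotp (y - p) (z - p) = 0].

Definition horizontal_axis : set (R * R) := [set y | y.2 = 0].

Lemma dotp_gt0 v : v != 0 -> 0 < dotp v v.
Proof.
case: v => a b v0; rewrite /dotp /= -!expr2 lt0r paddr_eq0 ?sqr_ge0//.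
rewrite addr_ge0 ?sqr_ge0// andbT !sqrf_eq0; apply: contra v0.
by move=> /andP[/eqP-> /eqP->].
Qed.

Lemma orth_projE p v y : v != 0 ->
  orth_proj (line_through p v) y = p + (dotp (y - p) v / dotp v v) *: v.
Proof.
move=> /dotp_gt0 v0; rewrite /orth_proj; set c := _ / _.
have cv : c * dotp v v = dotp (y - p) v by rewrite divfK// gt_eqF.
case: xgetP => [q -> [[t _ <-] orth]|none].
  have /orth : line_through p v (p + (t + 1) *: v) by exists (t + 1).
  move=> orthv; congr (_ + _ *: _); apply: (mulIf (lt0r_neq0 v0)).
  rewrite cv; move: orthv; rewrite /dotp/= /GRing.scale/=.
  move=> orthv; apply/eqP; rewrite eq_sym -subr_eq0 -orthv; apply/eqP; ring.
exfalso; apply: (none (p + c *: v)); split; first by exists c.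
move=> _ [t _ <-]; rewrite -[RHS](mulr0 (t - c)).
by rewrite -(subrr (dotp (y - p) v)) -{2}cv /dotp/= /GRing.scale/=; ring.
Qed.

End euclidean_plane.

Section hausdorff_measure.
Context {R : realType}.
Implicit Types (A E : set (R * R)) (delta : R).
Local Open Scope ereal_scope.

Definition hausdorff1_delta delta A : \bar R :=
  ereal_inf [set \sum_(k <oo) ediam (U k) | U in
    [set U : (set (R * R))^nat | A `<=` \bigcup_k U k /\
                                 forall k, ediam (U k) <= delta%:E]].

(* No normalising factor is needed in dimension one: the measure of a segment
   is its length. *)
Definition hausdorff1 A : \bar R :=
  ereal_sup [set hausdorff1_delta delta A | delta in [set d | (0 < d)%R]].

Lemma ediam_ge0 A : 0 <= ediam A.
Proof. by apply: ereal_sup_ubound; left. Qed.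

Lemma ediam0 : ediam (set0 : set (R * R)) = 0.
Proof.
rewrite /ediam [X in _ |` X](_ : _ = set0) ?setU0 ?ereal_sup1//.
by apply/seteqP; split => // x [? []].
Qed.

Lemma hausdorff1_delta_ge0 delta A : 0 <= hausdorff1_delta delta A.
Proof.
by apply: le_ereal_inf_tmp => _ [U _ <-]; apply: nneseries_ge0 => *;
  exact: ediam_ge0.
Qed.

Lemma hausdorff1_delta0 delta : (0 < delta)%R -> hausdorff1_delta delta set0 = 0.
Proof.
move=> d0; apply/eqP; rewrite eq_le hausdorff1_delta_ge0 andbT.
apply: ereal_inf_lbound; exists (fun=> set0).
  by split => // k; rewrite ediam0 lee_fin ltW.
by apply: eseries0 => k _ _; rewrite ediam0.
Qed.

Lemma hausdorff1_delta_subset delta :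
  {homo hausdorff1_delta delta : A B / A `<=` B >-> A <= B}.
Proof.
move=> A B AB; apply/ereal_inf_le_tmp => _ [U [BU dU] <-].
by exists U => //; split => //; exact: subset_trans BU.
Qed.

Lemma hausdorff1_delta_sigma_subadditive delta : (0 < delta)%R ->
  sigma_subadditive (hausdorff1_delta delta).
Proof.
move=> d0 A; set mu := hausdorff1_delta delta.
have mu_ge0 := hausdorff1_delta_ge0 delta.
have [[i ioo]|] := pselect (exists i, mu (A i) = +oo).
  rewrite (eseries_pinfty _ _ ioo) ?leey// => n _.
  by rewrite -ltNye (lt_le_trans _ (mu_ge0 _)).
rewrite -forallNE => Aoo.
suff add2e (e : {posnum R}) :
    mu (\bigcup_n A n) <= \sum_(i <oo) mu (A i) + e%:num%:E.
  by apply/lee_addgt0Pr => _/posnumP[].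
apply: (le_trans _ (epsilon_trick _ _ _)) => //.
pose P n (U : (set (R * R))^nat) :=
  [/\ A n `<=` \bigcup_k U k, forall k, ediam (U k) <= delta%:E &
    \sum_(k <oo) ediam (U k) <= mu (A n) + (e%:num / (2 ^ n.+1)%:R)%:E].
have [G PG] : {G : ((set (R * R))^nat)^nat & forall n, P n (G n)}.
  apply: (@choice _ _ P) => n.
  have en : (0 < e%:num / (2 ^ n.+1)%:R)%R by [].
  have mufin : mu (A n) \is a fin_num.
    by rewrite ge0_fin_numE// ltey; apply/eqP/Aoo.
  have [_ [U [AU dU] <-] ltU] := lb_ereal_inf_adherent en mufin.
  by exists U; split => //; exact/ltW.
have /card_esym/ppcard_eqP[f] := card_nat2.
have G_ge0 x : 0 <= (@ediam R \o uncurry G) x by exact: ediam_ge0.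
apply: (@le_trans _ _ (\esum_(i in setT) (@ediam R \o uncurry G) i)).
  apply: ereal_inf_lbound => /=; exists (uncurry G \o f).
    split=> [t [i _]|k].
      case: (PG i) => + _ _ => /[apply] -[j _ Gt].
      by exists (f^-1%FUN (i, j)) => //=; rewrite invK ?inE.
    by rewrite /=; case: (f k) => i j /=; case: (PG i).
  rewrite -(esum_pred_image (@ediam R \o uncurry G) _ xpredT) ?[fun=> _]set_true//.
  by rewrite image_eq.
rewrite (_ : esum _ _ = \sum_(i <oo) \sum_(j <oo) ediam (G i j)).
  apply: lee_lim.
  - by apply: is_cvg_nneseries => *; apply: nneseries_ge0 => *; exact: ediam_ge0.
  - by apply: is_cvg_nneseries => *; rewrite adde_ge0.
  - by near=> n; apply: lee_sum => i _; case: (PG i).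
pose J : nat -> set (nat * nat) := fun i => [set (i, j) | j in setT].
rewrite (_ : setT = \bigcup_k J k); last first.
  by rewrite predeqE => -[a b]; split => // _; exists a => //; exists b.
rewrite esum_bigcupT /=; last 2 first.
- apply/trivIsetP => i j _ _ ij.
  rewrite predeqE => -[n m] /=; split => //= -[] [_] _ [<-{n} _].
  by move=> [m' _] [] /esym/eqP; rewrite (negbTE ij).
- by move=> ?; exact: ediam_ge0.
rewrite -(image_id [set: nat]) -fun_true esum_pred_image//; last first.
  by move=> n _; apply: esum_ge0 => *; exact: ediam_ge0.
apply: eq_eseriesr => /= j _.
rewrite -(esum_pred_image (@ediam R \o uncurry G) (pair j) predT)//=.
- by congr esum; rewrite predeqE => -[a b]; split; move=> [i _ <-]; exists i.
- by move=> *; exact: ediam_ge0.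
- by move=> ? ? _ _; exact: (@can_inj _ _ _ snd).
Unshelve. all: by end_near. Qed.

Lemma hausdorff1_0 : hausdorff1 set0 = 0.
Proof.
apply/eqP; rewrite eq_le; apply/andP; split.
  by apply: ge_ereal_sup => _ [d d0 <-]; rewrite hausdorff1_delta0.
by apply: ereal_sup_ubound; exists 1%R; rewrite /= ?ltr01// hausdorff1_delta0.
Qed.

Lemma hausdorff1_ge0 A : 0 <= hausdorff1 A.
Proof.
apply: (le_trans (hausdorff1_delta_ge0 1 A)).
by apply: ereal_sup_ubound; exists 1%R => //=; rewrite ltr01.
Qed.

Lemma hausdorff1_subset : {homo hausdorff1 : A B / A `<=` B >-> A <= B}.
Proof.
move=> A B AB; apply: ge_ereal_sup => _ [d d0 <-].
apply: (le_trans (hausdorff1_delta_subset d AB)).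
by apply: ereal_sup_ubound; exists d.
Qed.

Lemma hausdorff1_sigma_subadditive : sigma_subadditive hausdorff1.
Proof.
move=> A; apply: ge_ereal_sup => _ [d d0 <-].
apply: (le_trans (hausdorff1_delta_sigma_subadditive d0 A)).
apply: lee_nneseries => *; last by apply: ereal_sup_ubound; exists d.
exact: hausdorff1_delta_ge0.
Qed.

HB.instance Definition _ := isOuterMeasure.Build R (R * R)%type hausdorff1
  hausdorff1_0 hausdorff1_ge0 hausdorff1_subset hausdorff1_sigma_subadditive.

Definition hausdorff1_restr E A : \bar R := hausdorff1 (A `&` E).

Lemma hausdorff1_restr0 E : hausdorff1_restr E set0 = 0.
Proof. by rewrite /hausdorff1_restr set0I outer_measure0. Qed.

Lemma hausdorff1_restr_ge0 E A : 0 <= hausdorff1_restr E A.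
Proof. exact: outer_measure_ge0. Qed.

Lemma hausdorff1_restr_subset E :
  {homo hausdorff1_restr E : A B / A `<=` B >-> A <= B}.
Proof. by move=> A B AB; apply: le_outer_measure; exact: setSI. Qed.

Lemma hausdorff1_restr_sigma_subadditive E :
  sigma_subadditive (hausdorff1_restr E).
Proof.
move=> A; rewrite /hausdorff1_restr setI_bigcupl.
exact: outer_measure_sigma_subadditive.
Qed.

HB.instance Definition _ E := isOuterMeasure.Build R (R * R)%type
  (hausdorff1_restr E) (hausdorff1_restr0 E) (hausdorff1_restr_ge0 E)
  (@hausdorff1_restr_subset E) (@hausdorff1_restr_sigma_subadditive E).

End hausdorff_measure.

Section line_coefficients.
Context {R : realType}.
Implicit Types (E S V : set (R * R)) (q : R).
Local Open Scope ereal_scope.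

Definition hausdorff1_outer E : {outer_measure set (R * R) -> \bar R} :=
  hausdorff1_restr E.

(* The sigma-algebra is that of the Caratheodory measurable sets of the outer
   measure [hausdorff1_restr E], which contains the Borel sets. *)
Definition hausdorff1_on E :
    {measure set (caratheodory_type (hausdorff1_outer E)) -> \bar R} :=
  (hausdorff1_outer E : set (caratheodory_type (hausdorff1_outer E)) -> \bar R).

Definition beta_coef E q S : \bar R :=
  ereal_inf [set ((hausdorff1_on E S)^-1 *
      \int[hausdorff1_on E]_(y in S)
        (((dist_set y V / diam S) `^ q)%R)%:E) `^ q^-1
    | V in affine_line].

Definition iota_coef E q S : \bar R :=
  ereal_inf [set ((hausdorff1_on E S ^+ 2)^-1 *
      \int[hausdorff1_on E]_(y in S) \int[hausdorff1_on E]_(z in S)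
        (((`|enorm (y - z) - enorm (orth_proj V y - orth_proj V z)| / diam S)
          `^ q)%R)%:E) `^ q^-1
    | V in affine_line].

End line_coefficients.

(* Main.v *)
Require Import Defs.
From mathcomp Require Import all_boot all_order all_algebra.
From mathcomp Require Import all_classical all_reals all_analysis.
From mathcomp Require Import measurable_realfun ring lra.

Import Order.TTheory GRing.Theory Num.Theory.
Import numFieldNormedType.Exports.

Local Open Scope classical_set_scope.
Local Open Scope ring_scope.

(**
Write h = eps r for the gap between the lines. For beta, the line l_0 itself
gives the upper bound, and for the lower bound an affine function of unit slope
cannot be smaller than h/8 in absolute value at points of three well-spread
segments, two on one line and one on the other.

For iota, fix a line V and a point y of the line containing x. On one of the two
sides of y, the vectors from y to the other line, with horizontal extent t >= h,
have components along the axis and across it whose contributions to the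
projection on V have opposite signs. There |pi(y) - pi(z)| <= t, whereas
|y - z| >= t + h^2 / (3 t). Each dyadic range of t between h and r / 2 thus
contributes at least a constant times r (eps^2 / 18)^q to the inner integral, and
there are about log (1 / eps) of them.
*)

(** * Euclidean norm, diameters and horizontal segments *)

Section plane.
Context {R : realType}.
Implicit Types (y z v p : R * R) (a b c d m rho delta : R).

Lemma enorm_ge0 y : 0 <= enorm y.
Proof. exact: sqrtr_ge0. Qed.

Lemma enormE y : enorm y = Num.sqrt (y.1 ^+ 2 + y.2 ^+ 2).
Proof. by rewrite /enorm /dotp -!expr2. Qed.

Lemma sqr_enorm y : enorm y ^+ 2 = y.1 ^+ 2 + y.2 ^+ 2.
Proof. by rewrite enormE sqr_sqrtr// addr_ge0 ?sqr_ge0. Qed.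

Lemma enorm_le y d : 0 <= d -> (enorm y <= d) = (y.1 ^+ 2 + y.2 ^+ 2 <= d ^+ 2).
Proof. by move=> d0; rewrite -sqr_enorm ler_sqr ?nnegrE ?enorm_ge0. Qed.

Lemma enorm_ge y d : 0 <= d -> (d <= enorm y) = (d ^+ 2 <= y.1 ^+ 2 + y.2 ^+ 2).
Proof. by move=> d0; rewrite -sqr_enorm ler_sqr ?nnegrE ?enorm_ge0. Qed.

Lemma enorm_lt y d : 0 <= d -> (enorm y < d) = (y.1 ^+ 2 + y.2 ^+ 2 < d ^+ 2).
Proof. by move=> d0; rewrite ltNge enorm_ge// -ltNge. Qed.

Lemma norm_fst_le_enorm y : `|y.1| <= enorm y.
Proof. by rewrite enorm_ge// -normrX ger0_norm ?sqr_ge0 ?lerDl ?sqr_ge0. Qed.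

Lemma norm_snd_le_enorm y : `|y.2| <= enorm y.
Proof. by rewrite enorm_ge// -normrX ger0_norm ?sqr_ge0 ?lerDr ?sqr_ge0. Qed.

Lemma enorm_le_add y : enorm y <= `|y.1| + `|y.2|.
Proof.
rewrite enorm_le ?addr_ge0// sqrrD !real_normK ?num_real//.
by rewrite -addrA lerD2l addrC lerDl mulrn_wge0// mulr_ge0.
Qed.

Lemma enorm_horizontal y : y.2 = 0 -> enorm y = `|y.1|.
Proof. by move=> y0; rewrite enormE y0 expr0n addr0 sqrtr_sqr. Qed.

Lemma enorm_vertical y : y.1 = 0 -> enorm y = `|y.2|.
Proof. by move=> y0; rewrite enormE y0 expr0n add0r sqrtr_sqr. Qed.

Lemma ediam_le (S : set (R * R)) d : 0 <= d ->
  (forall y z, S y -> S z -> enorm (y - z) <= d) -> (ediam S <= d%:E)%E.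
Proof.
move=> d0 Sd; apply: ge_ereal_sup => _ [->|[y Sy [z Sz <-]]].
  by rewrite lee_fin.
by rewrite lee_fin Sd.
Qed.

Lemma enorm_le_ediam (S : set (R * R)) y z : S y -> S z ->
  ((enorm (y - z))%:E <= ediam S)%E.
Proof. by move=> Sy Sz; apply: ereal_sup_ubound; right; exists y => //; exists z. Qed.

Definition hline c : set (R * R) := [set y | y.2 = c].

Definition hseg c m rho : set (R * R) := [set y | y.2 = c /\ `|y.1 - m| < rho].

Definition hseg_closed c m rho : set (R * R) :=
  [set y | y.2 = c /\ `|y.1 - m| <= rho].

Lemma hseg_closed_split c m rho :
  hseg_closed c m rho `<=`
  hseg_closed c (m - rho / 2) (rho / 2) `|` hseg_closed c (m + rho / 2) (rho / 2).
Proof.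
move=> y [yc]; rewrite ler_norml => /andP[? ?].
by have [ym|ym] := leP y.1 m; [left|right]; split => //; rewrite ler_norml;
  apply/andP; split; lra.
Qed.

Local Open Scope ereal_scope.

(** * Hausdorff measure of horizontal segments *)

Lemma hausdorff1_deltaU delta (A B : set (R * R)) : (0 < delta)%R ->
  hausdorff1_delta delta (A `|` B) <=
  hausdorff1_delta delta A + hausdorff1_delta delta B.
Proof.
move=> delta0; rewrite -bigcup2E.
apply: le_trans (hausdorff1_delta_sigma_subadditive delta0 _) _.
rewrite (@nneseries_split _ _ 0%N 2)//; last first.
  by move=> k _; exact: hausdorff1_delta_ge0.
rewrite add0n big_mkord !big_ord_recl big_ord0 /= adde0 eseries0 ?adde0//.
by move=> [|[|i]] //= _ _; rewrite hausdorff1_delta0.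
Qed.

(** Bisection: the induction is on a number [n] of halvings that brings the length down to [delta];
    a segment that short is its own cover. *)
Lemma hausdorff1_delta_hseg_closed delta c m rho :
  (0 < delta)%R -> (0 <= rho)%R ->
  hausdorff1_delta delta (hseg_closed c m rho) <= (2 * rho)%:E.
Proof.
move=> delta0 rho0.
have [n] : exists n, (2 * rho <= delta * 2 ^+ n)%R.
  (* For this [k] one has [2 * rho / delta < k <= 2 ^ k]. *)
  exists (Num.truncn (2 * rho / delta)).+1; rewrite [leRHS]mulrC -ler_pdivrMr//.
  apply: le_trans (ltW (truncnS_gt _)) _.
  set k := (Num.truncn _).+1; have := ltnW (ltn_expl k (ltnSn 1)).
  by rewrite -(ler_nat R) natrX.
elim: n m rho rho0 => [|n ih] m rho rho0 le_rho.
  have dS : ediam (hseg_closed c m rho) <= (2 * rho)%:E.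
    apply: ediam_le => [|y z [yc ym] [zc zm]]; first lra.
    rewrite enorm_horizontal/= ?yc ?zc ?subrr//.
    by move: ym zm; rewrite !ler_norml; lra.
  apply: ge_ereal_inf.
  (* Covers are infinite sequences, so the segment is padded with empty sets, of diameter 0. *)
  exists (\sum_(k <oo) ediam (bigcup2 (hseg_closed c m rho) set0 k)).
    exists (bigcup2 (hseg_closed c m rho) set0) => //; split.
      by rewrite bigcup2E setU0.
    move=> [|[|k]] /=; rewrite ?ediam0 ?lee_fin ?(ltW delta0)//.
    by apply: le_trans dS _; rewrite lee_fin; lra.
  rewrite (@nneseries_split _ _ 0%N 1)//; last by move=> k _; exact: ediam_ge0.
  rewrite add0n big_mkord !big_ord_recl big_ord0 /= adde0 eseries0 ?adde0//.
  by move=> [|[|i]] //= _ _; rewrite ediam0.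
apply: le_trans (hausdorff1_delta_subset delta (hseg_closed_split c m rho)) _.
apply: le_trans (hausdorff1_deltaU _ _ _ delta0) _.
have -> : ((2 * rho)%:E = (2 * (rho / 2))%:E + (2 * (rho / 2))%:E).
  by rewrite -EFinD; congr EFin; lra.
by rewrite leeD// ih//; move: le_rho; rewrite ?exprS; lra.
Qed.

Lemma hausdorff1_hseg_closed c m rho : (0 <= rho)%R ->
  hausdorff1 (hseg_closed c m rho) <= (2 * rho)%:E.
Proof.
by move=> rho0; apply: ge_ereal_sup => _ [d d0 <-];
  exact: hausdorff1_delta_hseg_closed.
Qed.

(* A set of diameter [d] meets a horizontal line in a set contained in an
   interval of length [d], so covers of a segment have total diameter at least
   its Lebesgue measure. *)
Lemma hausdorff1_hseg_ge c m rho : (0 <= rho)%R ->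
  (2 * rho)%:E <= hausdorff1 (hseg c m rho).
Proof.
move=> rho0.
(* The scale 1 is arbitrary: the diameter bound only serves to make every [ediam (U k)] finite. *)
apply: (@le_trans _ _ (hausdorff1_delta 1 (hseg c m rho))); last first.
  by apply: ereal_sup_ubound; exists 1%R => //=; rewrite ltr01.
apply: le_ereal_inf_tmp => _ [U [SU dU] <-].
pose P k := [set u : R | U k (u, c)].
(* If the slice [P k] is empty, its infimum is a harmless default: only the length of [I k] and the
   inclusion of [P k] matter. *)
pose I k : set R := `[inf (P k), (inf (P k) + fine (ediam (U k)))%R]%classic.
have diamU k : (fine (ediam (U k)))%:E = ediam (U k).
  rewrite fineK// ge0_fin_numE ?ediam_ge0//.
  by apply: le_lt_trans (dU k) _; rewrite ltry.
have PI k : P k `<=` I k.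
  move=> u Pu; rewrite /I/= in_itv/=.
  have ulb w : P k w -> (u - fine (ediam (U k)) <= w)%R.
    move=> Pw; have := @enorm_le_ediam _ _ _ Pu Pw.
    rewrite -diamU lee_fin enorm_horizontal/= ?subrr// ler_norml.
    by move=> /andP[? ?]; lra.
  apply/andP; split.
    by apply: ge_inf => //; exists (u - fine (ediam (U k)))%R => w /ulb.
  rewrite -lerBlDr; apply: lb_le_inf; first by exists u.
  by move=> w /ulb.
have : lebesgue_measure (`](m - rho)%R, (m + rho)%R[%classic : set R) <=
    \sum_(k <oo) lebesgue_measure (I k).
  apply: measure_sigma_subadditive => [k||u /=]; try exact: measurable_itv.
  rewrite in_itv/= => /andP[? ?].
  have /SU[k _ Uk] : hseg c m rho (u, c).
    by split => //=; rewrite ltr_norml; apply/andP; split; lra.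
  by exists k => //; exact: PI.
rewrite lebesgue_measure_itv/= lte_fin.
case: ifPn => [_|]; last first.
  rewrite -leNgt => ? _; apply: (@le_trans _ _ 0); first by rewrite lee_fin; lra.
  by apply: nneseries_ge0 => *; exact: ediam_ge0.
rewrite -EFinB (_ : m + rho - (m - rho) = 2 * rho)%R; last lra.
move=> /le_trans; apply; apply: lee_nneseries => // k _.
rewrite lebesgue_measure_itv/=; case: ifPn => _; last exact: ediam_ge0.
by rewrite -EFinB addrAC subrr add0r diamU.
Qed.

Lemma hseg_sub_closed c m rho : hseg c m rho `<=` hseg_closed c m rho.
Proof. by move=> y [yc /ltW]. Qed.

Lemma hausdorff1_hseg c m rho : (0 <= rho)%R ->
  hausdorff1 (hseg c m rho) = (2 * rho)%:E.
Proof.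
move=> rho0; apply/eqP; rewrite eq_le hausdorff1_hseg_ge// andbT.
apply: le_trans (hausdorff1_subset (@hseg_sub_closed c m rho)) _.
exact: hausdorff1_hseg_closed.
Qed.

(** * Additivity on separated sets and measurability of segments *)

Lemma hausdorff1_delta_le d1 d2 (A : set (R * R)) : (d1 <= d2)%R ->
  hausdorff1_delta d2 A <= hausdorff1_delta d1 A.
Proof.
move=> d12; apply: le_ereal_inf_tmp => _ [U [AU dU] <-].
apply: ereal_inf_lbound; exists U => //; split => // k.
by apply: le_trans (dU k) _; rewrite lee_fin.
Qed.

(** A set of diameter at most [d] cannot meet both [A] and [B], so a cover of the union splits into
    a cover of each. *)
Lemma hausdorff1_delta_separated d (A B : set (R * R)) : (0 < d)%R ->
  (forall y z, A y -> B z -> (d < enorm (y - z))%R) ->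
  hausdorff1_delta d A + hausdorff1_delta d B <= hausdorff1_delta d (A `|` B).
Proof.
move=> d0 AB; apply: le_ereal_inf_tmp => _ [U [ABU dU] <-].
(* Members of the cover that miss [C] are replaced by the empty set. *)
pose M (C : set (R * R)) k := if pselect (U k `&` C !=set0) then U k else set0.
have leM (C : set (R * R)) : C `<=` A `|` B ->
    hausdorff1_delta d C <= \sum_(k <oo) ediam (M C k).
  move=> CAB; apply: ereal_inf_lbound; exists (M C) => //; split.
    move=> y Cy; have /ABU[k _ Uy] := CAB _ Cy.
    by exists k => //; rewrite /M; case: pselect => // -[]; exists y.
  move=> k; rewrite /M; case: pselect => [a|a]; first exact: dU.
  by rewrite ediam0 lee_fin ltW.
apply: le_trans (leeD (leM A (@subsetUl _ _ _)) (leM B (@subsetUr _ _ _))) _.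
rewrite -nneseriesD; try by move=> *; exact: ediam_ge0.
apply: lee_nneseries => [k _ _|k _]; first by rewrite adde_ge0 ?ediam_ge0.
have diamM (C : set (R * R)) : ediam (M C k) <= ediam (U k).
  by rewrite /M; case: pselect => [a|a]; rewrite ?ediam0 ?ediam_ge0.
have [[y [Uy Ay]]|nA] := pselect (U k `&` A !=set0); last first.
  rewrite [M A k](_ : _ = set0) ?ediam0 ?add0r//.
  by rewrite /M; case: pselect.
have [[z [Uz Bz]]|nB] := pselect (U k `&` B !=set0); last first.
  rewrite [M B k](_ : _ = set0) ?ediam0 ?addr0//.
  by rewrite /M; case: pselect.
have := le_trans (@enorm_le_ediam _ _ _ Uy Uz) (dU k).
by rewrite lee_fin leNgt AB.
Qed.

Lemma hausdorff1_separated d (A B : set (R * R)) : (0 < d)%R ->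
  (forall y z, A y -> B z -> (d <= enorm (y - z))%R) ->
  hausdorff1 A + hausdorff1 B <= hausdorff1 (A `|` B).
Proof.
move=> d0 AB; have [ABoo|] := eqVneq (hausdorff1 (A `|` B)) +oo.
  by rewrite ABoo leey.
rewrite -ltey => ABoo.
have Bfin : hausdorff1 B \is a fin_num.
  rewrite ge0_fin_numE ?hausdorff1_ge0//; apply: le_lt_trans ABoo.
  exact/hausdorff1_subset/subsetUr.
rewrite -leeBrDr//; apply: ge_ereal_sup => _ [d1 d10 <-].
have Afin : hausdorff1_delta d1 A \is a fin_num.
  rewrite ge0_fin_numE ?hausdorff1_delta_ge0//; apply: le_lt_trans ABoo.
  apply: (@le_trans _ _ (hausdorff1 A)).
    by apply: ereal_sup_ubound; exists d1.
  exact/hausdorff1_subset/subsetUl.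
rewrite leeBrDr// addrC -leeBrDr//; apply: ge_ereal_sup => _ [d2 d20 <-].
rewrite leeBrDr// addrC.
(* A common refinement of both scales; halving [d] makes the separation strict. *)
pose dm := Num.min (Num.min d1 d2) (d / 2)%R.
have dm0 : (0 < dm)%R by rewrite !lt_min d10 d20 divr_gt0.
apply: (@le_trans _ _ (hausdorff1_delta dm (A `|` B))); last first.
  by apply: ereal_sup_ubound; exists dm.
apply: le_trans (@hausdorff1_delta_separated dm A B dm0 _); last first.
  move=> y z Ay Bz; apply: lt_le_trans (AB y z Ay Bz).
  by rewrite gt_min (_ : d / 2 < d)%R ?orbT//; lra.
by apply: leeD; apply: hausdorff1_delta_le; rewrite !ge_min lexx ?orbT.
Qed.

(* Caratheodory's argument for metric outer measures, with the exhaustion of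
   [F] by sets at positive distance from its complement given in advance. *)
Lemma hausdorff1_on_measurable (E F : set (R * R)) :
  (forall e, (0 < e)%R -> exists G, [/\ G `<=` F,
    hausdorff1 (F `\` G) <= e%:E &
    exists2 d, (0 < d)%R &
      forall y z, G y -> E z -> ~ F z -> (d <= enorm (y - z))%R]) ->
  measurable (F : set (caratheodory_type (hausdorff1_outer E))).
Proof.
move=> FG; apply: le_caratheodory_measurable => X; apply/lee_addgt0Pr => e e0.
have [G [GF Ge [d d0 Gd]]] := FG e e0.
rewrite /= /hausdorff1_restr.
have XF : hausdorff1 (X `&` F `&` E) <= hausdorff1 (X `&` G `&` E) + e%:E.
  apply: (@le_trans _ _ (hausdorff1 (X `&` G `&` E `|` F `\` G))).
    apply: hausdorff1_subset => y [[Xy Fy] Ey].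
    by have [Gy|nGy] := pselect (G y); [left|right].
  by apply: le_trans (outer_measureU2 _ _ _) _; rewrite leeD2l.
apply: le_trans (leeD XF (lexx _)) _.
rewrite addeAC leeD2r//; apply: le_trans (hausdorff1_separated _ _ _ d0 _) _.
  by move=> y z [[_ Gy] _] [[_ Fz] Ez]; exact: Gd.
by apply: hausdorff1_subset => y [] [[Xy _] Ey].
Qed.

(** The segment is exhausted by closed ones shortened by [e / 2] at each end. A point of the two
    lines outside the segment is at distance at least [e / 2] from these if it lies on the same
    line, and at least the gap otherwise. *)
Lemma hseg_measurable c1 c2 c m rho : c1 != c2 ->
  hline c `<=` hline c1 `|` hline c2 ->
  measurable (hseg c m rho : set (caratheodory_type
    (hausdorff1_outer (hline c1 `|` hline c2)))).
Proof.
move=> c12 cE; apply: hausdorff1_on_measurable => e e0.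
exists (hseg_closed c m (rho - e / 2)%R); split.
- by move=> y [yc ym]; split => //; apply: le_lt_trans ym _; lra.
- pose G b := hseg_closed c b (e / 4)%R.
  apply: (@le_trans _ _ (hausdorff1 (G (m - rho + e / 4)%R `|` G (m + rho - e / 4)%R))).
    apply: hausdorff1_subset => y [[yc ym] /not_andP[//|/negP]].
    rewrite -ltNge => my; move: ym my; rewrite ltr_norml => /andP[? ?].
    rewrite ltr_normr => /orP[?|?]; [right|left]; split => //;
      by rewrite ler_norml; apply/andP; split; lra.
  apply: le_trans (outer_measureU2 _ _ _) _.
  have -> : e%:E = (2 * (e / 4))%:E + (2 * (e / 4))%:E.
    by rewrite -EFinD; congr EFin; lra.
  by apply: leeD; apply: hausdorff1_hseg_closed; lra.
exists (Num.min (e / 2) `|c1 - c2|)%R.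
  by rewrite lt_min normr_gt0 subr_eq0 c12 divr_gt0.
move=> y z [yc ym] Ez nz; rewrite ge_min.
have [zc|zc] := eqVneq z.2 c.
  apply/orP; left; apply: le_trans (norm_fst_le_enorm _) => /=.
  have /negP : ~ (`|z.1 - m| < rho)%R by move=> zm; apply: nz.
  rewrite -leNgt => zm; have := ler_distD y.1 z.1 m.
  by rewrite [(`|z.1 - y.1|)%R]distrC; lra.
apply/orP; right; apply: le_trans (norm_snd_le_enorm _) => /=; rewrite yc.
have /cE[] : hline c (0%R, c) by []; rewrite /hline/= => cc;
  move: Ez zc => [] /= ->; rewrite cc ?eqxx// => _.
by rewrite distrC.
Qed.

Lemma hausdorff1_on_hseg (E : set (R * R)) c m rho : hline c `<=` E ->
  (0 <= rho)%R -> hausdorff1_on E (hseg c m rho) = (2 * rho)%:E.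
Proof.
move=> cE rho0; rewrite -(hausdorff1_hseg c m rho rho0).
rewrite /hausdorff1_on/= /hausdorff1_restr setIidl// => y [yc _].
exact: cE.
Qed.

End plane.

(** * Lower bounds for integrals by step functions *)

Section integral_lower_bounds.
Local Open Scope ereal_scope.
Context d (T : measurableType d) (R : realType).
Variable mu : {measure set T -> \bar R}.
Implicit Types (D : set T) (f g : T -> \bar R).

Import HBNNSimple.

(* Unlike [ge0_le_integral], no measurability: the integral of a nonnegative
   function is a supremum over the simple functions below it. *)
Lemma ge0_le_integral_nonmeasurable D f g : (forall x, D x -> 0 <= f x) ->
  (forall x, D x -> f x <= g x) ->
  \int[mu]_(x in D) f x <= \int[mu]_(x in D) g x.
Proof.
move=> f0 fg; rewrite !ge0_integralE//; last first.
  by move=> x Dx; apply: le_trans (fg _ Dx); exact: f0.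
apply: ereal_sup_le => _ [h hf <-]; exists h => //= x.
by apply: le_trans (hf x) _; apply: lee_restrict.
Qed.

(** The step function with value [k i] on the disjoint [Z i] lies below [f]. This is how the
    contributions of the dyadic pieces are added. *)
Lemma integral_ge_sum D f n (Z : 'I_n -> set T) (k : 'I_n -> R) :
  (forall x, D x -> 0 <= f x) ->
  (forall i, measurable (Z i)) -> (forall i, Z i `<=` D) ->
  (forall i j x, Z i x -> Z j x -> i = j) ->
  (forall i, (0 <= k i)%R) -> (forall i x, Z i x -> (k i)%:E <= f x) ->
  \sum_(i < n) (k i)%:E * mu (Z i) <= \int[mu]_(x in D) f x.
Proof.
move=> f0 mZ ZD disj k0 kf.
have mI i : measurable_fun [set: T] (EFin \o (\1_(Z i) : T -> R)).
  by apply/measurable_EFinP; exact: measurable_indic.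
apply: (@le_trans _ _
    (\int[mu]_x (\sum_(i < n) (k i)%:E * (\1_(Z i) x)%:E))).
  rewrite ge0_integral_sum//; last 2 first.
    by move=> i; apply: measurable_funeM; exact: mI.
    by move=> i x _; rewrite mule_ge0 ?lee_fin.
  apply: lee_sum => i _; rewrite ge0_integralZl_EFin//.
    by rewrite integral_indic// setIT.
  exact: mI.
rewrite [leRHS]integral_mkcond.
apply: ge0_le_integral_nonmeasurable => x _.
  by rewrite sume_ge0// => i _; rewrite mule_ge0 ?lee_fin.
have [[i Zi]|nZ] := pselect (exists i, Z i x).
  rewrite (bigD1 i)//= big1 ?adde0.
    rewrite indicE mem_set// mule1 patchE mem_set//; last exact: ZD Zi.
    exact: kf.
  move=> j ji; rewrite indicE memNset ?mule0// => Zj.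
  by move/eqP: ji; apply; exact: disj Zj Zi.
rewrite big1; first by apply: erestrict_ge0.
by move=> i _; rewrite indicE memNset ?mule0// => Zi; apply: nZ; exists i.
Qed.

Lemma integral_ge_cst D f (Z : set T) (k : R) :
  (forall x, D x -> 0 <= f x) -> measurable Z -> Z `<=` D -> (0 <= k)%R ->
  (forall x, Z x -> k%:E <= f x) -> k%:E * mu Z <= \int[mu]_(x in D) f x.
Proof.
move=> f0 mZ ZD k0 kf.
have := @integral_ge_sum D f 1 (fun=> Z) (fun=> k).
by rewrite big_ord_recl big_ord0 adde0; apply => // i j; rewrite !ord1.
Qed.

End integral_lower_bounds.

(** * Distances to lines, projections, dyadic scales and roots *)

Section lines.
Context {R : realType}.
Implicit Types (y z v p w : R * R).

Lemma enorm_gt0 v : v != 0 -> 0 < enorm v.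
Proof. by move=> v0; rewrite sqrtr_gt0 dotp_gt0. Qed.

(** For each point of the line, with [u] its difference to [y], this is Lagrange's identity:
    [|u|^2 |v|^2] minus the squared cross product of [u] and [v] is their squared scalar product.
    The cross product does not depend on the point. *)
Lemma dist_set_line_ge p v y : v != 0 ->
  `|v.2 * (y.1 - p.1) - v.1 * (y.2 - p.2)| / enorm v <=
  dist_set y (line_through p v).
Proof.
move=> v0; apply: lb_le_inf.
  by exists (enorm (y - (p + 0 *: v))); exists (p + 0 *: v) => //; exists 0.
move=> _ [_ [t _ <-] <-]; rewrite ler_pdivrMr ?enorm_gt0//.
rewrite -ler_sqr ?nnegrE ?mulr_ge0 ?enorm_ge0//.
rewrite exprMn !sqr_enorm real_normK ?num_real//= /GRing.scale/=.
set a := y.1; set b := y.2; set p1 := p.1; set p2 := p.2.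
set v1 := v.1; set v2 := v.2.
rewrite -subr_ge0.
have -> : ((a - (p1 + t * v1)) ^+ 2 + (b - (p2 + t * v2)) ^+ 2) *
    (v1 ^+ 2 + v2 ^+ 2) - (v2 * (a - p1) - v1 * (b - p2)) ^+ 2 =
    ((a - (p1 + t * v1)) * v1 + (b - (p2 + t * v2)) * v2) ^+ 2 by ring.
exact: sqr_ge0.
Qed.

Lemma orth_proj_defect_ge p v y z : v != 0 ->
  0 < `|(y - z).1| -> `|(y - z).2| <= `|(y - z).1| ->
  (y - z).1 * v.1 * ((y - z).2 * v.2) <= 0 ->
  (y - z).2 ^+ 2 / (3 * `|(y - z).1|) <=
  `|enorm (y - z) - enorm (orth_proj (line_through p v) y -
                           orth_proj (line_through p v) z)|.
Proof.
move=> v0; rewrite !orth_projE//.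
have -> : p + (dotp (y - p) v / dotp v v) *: v -
    (p + (dotp (z - p) v / dotp v v) *: v) =
    (dotp (y - z) v / dotp v v) *: v.
  rewrite opprD addrACA subrr add0r -scalerBl -mulrBl; congr (_ / _ *: _).
  by rewrite /dotp/=; ring.
move: (y - z) => w w10 w21 wv.
(* The sign condition makes the cross term of the squared scalar product nonpositive, and
   [w.2 ^+ 2 <= w.1 ^+ 2] bounds the rest by [w.1 ^+ 2 * dotp v v]. *)
have proj : enorm ((dotp w v / dotp v v) *: v) <= `|w.1|.
  rewrite enorm_le// real_normK ?num_real// /GRing.scale/= /GRing.scale/=.
  have dv0 := dotp_gt0 v0; have dvE : dotp v v = v.1 ^+ 2 + v.2 ^+ 2.
    by rewrite /dotp -!expr2.
  rewrite !exprMn -mulrDr -dvE -mulrA.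
  rewrite (_ : (dotp v v)^-1 ^+ 2 * dotp v v = (dotp v v)^-1); last first.
    by field; rewrite gt_eqF.
  rewrite ler_pdivrMr// dvE /dotp.
  have : w.2 ^+ 2 * v.2 ^+ 2 <= w.1 ^+ 2 * v.2 ^+ 2.
    rewrite ler_wpM2r ?sqr_ge0// -[leLHS]real_normK ?num_real//.
    by rewrite -[leRHS]real_normK ?num_real// ler_sqr ?nnegrE.
  move: wv; move: w.1 w.2 v.1 v.2 => a b c d wv le.
  suff -> : (a * c + b * d) ^+ 2 =
      a ^+ 2 * c ^+ 2 + b ^+ 2 * d ^+ 2 + 2 * (a * c * (b * d)) by lra.
  by ring.
apply: le_trans (ler_norm _).
suff : `|w.1| + w.2 ^+ 2 / (3 * `|w.1|) <= enorm w by lra.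
set t := `|w.1|; set h := `|w.2|.
have -> : w.2 ^+ 2 = h ^+ 2 by rewrite real_normK ?num_real.
have h0 : 0 <= h by exact: normr_ge0.
rewrite enorm_ge; last by rewrite addr_ge0 ?divr_ge0 ?sqr_ge0 ?mulr_ge0// ltW.
have -> : w.1 ^+ 2 + w.2 ^+ 2 = t ^+ 2 + h ^+ 2 by rewrite !real_normK ?num_real.
have t0 : t != 0 by rewrite gt_eqF.
(* As [h <= t], this is at most [t ^+ 2 + (2 / 3 + 1 / 9) * h ^+ 2], which is why the factor 3
   suffices. *)
have -> : (t + h ^+ 2 / (3 * t)) ^+ 2 =
    t ^+ 2 + 2 / 3 * h ^+ 2 + h ^+ 2 * (h / t) ^+ 2 / 9.
  by field.
have : h ^+ 2 * (h / t) ^+ 2 <= h ^+ 2.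
  rewrite ler_piMr ?sqr_ge0// expr_le1// ?divr_ge0// ?ler_pdivrMr ?mul1r//.
  exact: ltW.
have := sqr_ge0 h; lra.
Qed.

Lemma hline_affine c : affine_line (hline c : set (R * R)).
Proof.
exists (0, c); exists (1, 0).
  by apply/eqP => -[] /eqP; rewrite oner_eq0.
apply/seteqP; split => [y yc|_ [t _ <-]].
  exists y.1 => //; rewrite [RHS]surjective_pairing yc.
  by congr pair => /=; rewrite /GRing.scale/=; ring.
by rewrite /hline/= /GRing.scale/=; ring.
Qed.

Lemma dist_set_hline_le c y : dist_set y (hline c) <= `|y.2 - c|.
Proof.
rewrite -[`|_|](@enorm_vertical _ (y - (y.1, c)))/= ?subrr//.
apply: ge_inf; first by exists 0 => _ [z _ <-]; exact: enorm_ge0.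
by exists (y.1, c).
Qed.

Lemma dist_set_ge0 y (V : set (R * R)) : V !=set0 -> 0 <= dist_set y V.
Proof.
move=> [z Vz]; apply: lb_le_inf; first by exists (enorm (y - z)); exists z.
by move=> _ [t _ <-]; exact: enorm_ge0.
Qed.

(** [N + 1] is the least exponent with [2 ^ (N + 1) * eps > 1 / 2], and [N >= 1] since
    [eps <= 1 / 4]. Hence [ln eps^-1 <= (N + 2) * ln 2 <= N + 2 <= 3 * N]. *)
Lemma dyadic_scales (eps : R) : 0 < eps <= 4^-1 ->
  exists N : nat, 2 ^+ N * eps <= 2^-1 /\ ln eps^-1 <= 3 * N%:R.
Proof.
move=> /andP[eps0 eps4].
have [] := @ex_minnP (fun n => 2^-1 < 2 ^+ n * eps).
  set k := (Num.truncn (2^-1 / eps)).+1; exists k.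
  rewrite -ltr_pdivrMr//; apply: lt_trans (truncnS_gt _) _.
  by have := ltn_expl k (ltnSn 1); rewrite -(ltr_nat R) natrX.
move=> [|[|n]]; rewrite ?expr0 ?expr1 => n2 nmin; [lra|lra|].
exists n.+1; split; first by rewrite leNgt; apply/negP => /nmin; rewrite ltnn.
have ln2 : ln 2 <= 1 :> R.
  by have := @le_ln1Dx R 1; rewrite -natr1 addrC; apply; lra.
have : ln eps^-1 <= ln (2 ^+ n.+3).
  rewrite ler_ln ?posrE ?invr_gt0 ?exprn_gt0//.
  by rewrite invf_ple ?posrE ?exprn_gt0// -[leLHS]mul1r ler_pdivrMr ?exprn_gt0//;
    move: n2; rewrite (exprS _ n.+2); nra.
rewrite lnXn// => /le_trans; apply.
rewrite -[leLHS]mulr_natl; apply: (@le_trans _ _ n.+3%:R).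
  by rewrite ler_piMr// ler0n.
by rewrite -[3]/(3%:R) -natrM ler_nat mulnS -[n.+3]/(3 + n)%N leq_add2l leq_pmull.
Qed.

(** The root turns [w] into a power with exponent [q^-1 <= 1], which is at least [w] because
    [w <= 1]. So constants lost under the integral stay independent of [q]. *)
Lemma root_ge (q k w L : R) (I : \bar R) : 1 <= q -> 0 <= k -> 0 <= w <= 1 ->
  0 <= L -> ((k `^ q * (w * L))%:E <= I)%E ->
  ((k * w * L `^ q^-1)%:E <= I `^ q^-1)%E.
Proof.
move=> q1 k0 /andP[w0 w1] L0 leI.
have q0 : 0 < q by lra.
apply: (@le_trans _ _ ((k `^ q * (w * L))%:E `^ q^-1)%E); last first.
  apply: gt0_ler_poweR => //; first by rewrite invr_ge0 ltW.
    by rewrite in_itv/= leey andbT lee_fin mulr_ge0 ?powR_ge0// mulr_ge0.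
  rewrite in_itv/= leey andbT; apply: le_trans leI.
  by rewrite lee_fin mulr_ge0 ?powR_ge0// mulr_ge0.
rewrite poweR_EFin lee_fin !powRM ?powR_ge0 ?mulr_ge0//.
rewrite -powRrM mulfV ?gt_eqF// powRr1// mulrA.
rewrite ler_wpM2r ?powR_ge0// ler_wpM2l//.
have [->|wn0] := eqVneq w 0; first exact: powR_ge0.
rewrite -[leLHS](powRr1 w0); apply: ger_powR; first by rewrite w1 lt0r wn0 w0.
by rewrite invf_le1.
Qed.

End lines.

(** * The trace of the ball on two horizontal lines, centred on the line at height [c1] *)

Section two_lines.
Context {R : realType}.
Implicit Types (y z v p w : R * R).
Variables (c1 c2 eps r : R) (x : R * R).
Hypotheses (eps_bounds : 0 < eps <= 4^-1) (r0 : 0 < r).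
Hypotheses (gap : `|c1 - c2| = eps * r) (xc : x.2 = c1).

Let E : set (R * R) := hline c1 `|` hline c2.
Let S : set (R * R) := eball x r `&` E.
Let mu := hausdorff1_on E.

Let eps0 : 0 < eps. Proof. by case/andP: eps_bounds. Qed.
Let eps4 : eps <= 4^-1. Proof. by case/andP: eps_bounds. Qed.

Let h0 : 0 < eps * r. Proof. exact: mulr_gt0. Qed.

Let h4 : eps * r <= r / 4. Proof. by rewrite mulrC ler_pM2l. Qed.

Let c12 : c1 != c2. Proof. by rewrite -subr_eq0 -normr_gt0 gap. Qed.

Local Ltac lra_section := move: r0 h0 h4 eps0 => ? ? ? ?; lra.

Let gap2 : (c1 - c2) ^+ 2 = (eps * r) ^+ 2.
Proof. by rewrite -[LHS]real_normK ?num_real// gap. Qed.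

Let ballE y : eball x r y <-> (y.1 - x.1) ^+ 2 + (y.2 - x.2) ^+ 2 < r ^+ 2.
Proof. by rewrite /eball/= enorm_lt// ltW. Qed.

Let hseg1_sub m rho : `|m - x.1| + rho <= r -> hseg c1 m rho `<=` S.
Proof.
move=> mr y [yc ym]; split; last by left.
apply/ballE; rewrite yc xc subrr expr0n addr0 -[ltLHS]real_normK ?num_real//.
rewrite ltr_sqr ?nnegrE ?(ltW r0)//; apply: lt_le_trans mr.
by have := ler_distD m y.1 x.1; lra_section.
Qed.

(** The margin absorbs the gap, which is at most [r / 4]: [(3 / 4) ^ 2 + (1 / 4) ^ 2 < 1]. *)
Let hseg2_sub m rho : `|m - x.1| + rho <= 3 * r / 4 -> hseg c2 m rho `<=` S.
Proof.
move=> mr y [yc ym]; split; last by right.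
apply/ballE; rewrite yc xc -[X in _ + X]sqrrN opprB gap2.
have : (y.1 - x.1) ^+ 2 <= (3 * r / 4) ^+ 2.
  rewrite -[leLHS]real_normK ?num_real//.
  rewrite ler_sqr ?nnegrE ?divr_ge0 ?mulr_ge0 ?(ltW r0)//.
  by have := ler_distD m y.1 x.1; lra_section.
have : (eps * r) ^+ 2 <= (r / 4) ^+ 2.
  by rewrite ler_sqr ?nnegrE ?(ltW h0)// divr_ge0// ltW.
have : 0 < r ^+ 2 by rewrite exprn_gt0.
lra_section.
Qed.

Let hseg_mu c m rho : hline c `<=` E -> 0 <= rho ->
  mu (hseg c m rho) = (2 * rho)%:E.
Proof. exact: hausdorff1_on_hseg. Qed.

Let E1 : hline c1 `<=` E. Proof. by move=> y; left. Qed.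

Let E2 : hline c2 `<=` E. Proof. by move=> y; right. Qed.

Let S_hseg : S = hseg c1 x.1 r `|` hseg c2 x.1 (Num.sqrt (r ^+ 2 - (eps * r) ^+ 2)).
Proof.
have hr : 0 <= r ^+ 2 - (eps * r) ^+ 2.
  by rewrite subr_ge0 ler_sqr ?nnegrE ?(ltW r0) ?(ltW h0)//; lra_section.
apply/seteqP; split => [y [/ballE yr [] yc]|y [|[yc]]].
- left; split => //; rewrite -ltr_sqr ?nnegrE ?(ltW r0)// real_normK ?num_real//.
  by move: yr; rewrite yc xc subrr expr0n addr0.
- right; split => //; rewrite -ltr_sqr ?nnegrE ?sqrtr_ge0// real_normK ?num_real//.
  rewrite sqr_sqrtr// ltrBrDr.
  by move: yr; rewrite yc xc -[X in _ + X < _]sqrrN opprB gap2.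
- by apply: hseg1_sub; rewrite subrr normr0 add0r.
rewrite -ltr_sqr ?nnegrE ?sqrtr_ge0// real_normK ?num_real// sqr_sqrtr//.
move=> yr; split; last by right.
by apply/ballE; rewrite yc xc -[X in _ + X]sqrrN opprB gap2 -ltrBrDr.
Qed.

Let S_measurable : measurable (S : set (caratheodory_type (hausdorff1_outer E))).
Proof. by rewrite S_hseg; apply: measurableU; apply: hseg_measurable. Qed.

Let mu_S : exists2 s : R, 2 * r <= s <= 4 * r & mu S = s%:E.
Proof.
have le4 : (mu S <= (4 * r)%:E)%E.
  rewrite S_hseg; apply: le_trans (outer_measureU2 (hausdorff1_outer E) _ _) _.
  have -> : (4 * r)%:E = ((2 * r)%:E + (2 * r)%:E)%E.
    by rewrite -EFinD; congr EFin; lra_section.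
  apply: leeD; first by rewrite -(hseg_mu _ x.1 _ E1 (ltW r0)).
  apply: (@le_trans _ _ (2 * Num.sqrt (r ^+ 2 - (eps * r) ^+ 2))%:E).
    by rewrite -(hseg_mu _ x.1 _ E2 (sqrtr_ge0 _)).
  rewrite lee_fin ler_pM2l//.
  rewrite -ler_sqr ?nnegrE ?sqrtr_ge0 ?(ltW r0)// sqr_sqrtr.
    by rewrite gerBl sqr_ge0.
  by rewrite subr_ge0 ler_sqr ?nnegrE ?(ltW r0) ?(ltW h0)//; lra_section.
have ge2 : ((2 * r)%:E <= mu S)%E.
  rewrite -(hseg_mu _ x.1 _ E1 (ltW r0)); apply: le_outer_measure.
  by apply: hseg1_sub; rewrite subrr normr0 add0r.
have fS : mu S \is a fin_num.
  by rewrite ge0_fin_numE ?measure_ge0// (le_lt_trans le4)// ltry.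
exists (fine (mu S)); last by rewrite fineK.
by rewrite -!lee_fin fineK// ge2.
Qed.

(** Below: the points of the first line at distance [r / 2] on either side of [x]. Above: less than
    [2 * r] horizontally, plus the gap. *)
Let diam_S : r <= diam S <= 3 * r.
Proof.
have le3 : (ediam S <= (3 * r)%:E)%E.
  apply: ediam_le => [|y z [/ballE yr Ey] [/ballE zr Ez]].
    by rewrite mulr_ge0// ltW.
  have small w : (w.1 - x.1) ^+ 2 + (w.2 - x.2) ^+ 2 < r ^+ 2 -> `|w.1 - x.1| < r.
    move=> wr; rewrite -ltr_sqr ?nnegrE ?(ltW r0)// real_normK ?num_real//.
    by apply: le_lt_trans wr; rewrite lerDl sqr_ge0.
  apply: le_trans (enorm_le_add _) _.
  have /= := ler_distD x.1 y.1 z.1; rewrite [`|x.1 - _|]distrC.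
  have := small _ yr; have := small _ zr.
  have : `|y.2 - z.2| <= eps * r; last by lra_section.
  by case: Ey => ->; case: Ez => ->; rewrite ?subrr ?normr0 ?(ltW h0)// ?gap//
    distrC gap.
have mem s : `|s| < r -> S (x.1 + s, c1).
  move=> sr; apply: (hseg1_sub x.1 r); first by rewrite subrr normr0 add0r.
  by split => //=; rewrite addrAC subrr add0r.
have ge1 : (r%:E <= ediam S)%E.
  have rr : `|r / 2| < r by rewrite ger0_norm ?divr_ge0 ?(ltW r0)//; lra_section.
  have := @enorm_le_ediam _ S _ _ (mem (r / 2) rr) (mem (- (r / 2)) _).
  rewrite normrN => /(_ rr); rewrite enorm_horizontal/= ?subrr//.
  rewrite (_ : x.1 + r / 2 - (x.1 - r / 2) = r); last by lra_section.
  by rewrite gtr0_norm.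
have fS : ediam S \is a fin_num.
  by rewrite ge0_fin_numE ?ediam_ge0// (le_lt_trans le3)// ltry.
by rewrite /diam -!lee_fin fineK// ge1.
Qed.

Let diam_gt0 : 0 < diam S.
Proof. by have /andP[? _] := diam_S; apply: lt_le_trans r0 _. Qed.

(** * Upper and lower bounds for [beta_coef] *)

Lemma beta_le (q : R) : 0 < q -> (beta_coef E q S <= eps%:E)%E.
Proof.
move=> q0; have [s /andP[s2 s4] muS] := mu_S.
have s0 : 0 < s by lra_section.
(* The competitor is the line of [E] through [x]: distances to it are at most [eps * r], and
   [r <= diam S]. *)
apply: ge_ereal_inf; eexists; first by exists (hline c1) => //; exact: hline_affine.
have dist_eps y : S y -> 0 <= dist_set y (hline c1) / diam S <= eps.
  move=> [_ Ey]; rewrite divr_ge0 ?(ltW diam_gt0)//=; last first.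
    by apply: dist_set_ge0; exists (0, c1).
  rewrite ler_pdivrMr//; apply: le_trans (dist_set_hline_le _ _) _.
  apply: (@le_trans _ _ (eps * r)); last first.
    by rewrite ler_pM2l//; have /andP[] := diam_S.
  by case: Ey => ->; rewrite ?subrr ?normr0 ?(ltW h0)// distrC gap.
have le_int : (\int[mu]_(y in S)
    (((dist_set y (hline c1) / diam S) `^ q)%R)%:E <= (eps `^ q * s)%:E)%E.
  rewrite EFinM -muS -(integral_cst _ S_measurable).
  apply: ge0_le_integral_nonmeasurable => y Sy; first by rewrite lee_fin powR_ge0.
  have /andP[d0 de] := dist_eps _ Sy.
  by rewrite lee_fin ge0_ler_powR ?nnegrE// ltW.
have int0 : (0 <= \int[mu]_(y in S)
    (((dist_set y (hline c1) / diam S) `^ q)%R)%:E)%E.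
  by apply: integral_ge0 => y _; rewrite lee_fin powR_ge0.
rewrite -[leRHS](_ : (eps `^ q)%:E `^ q^-1 = _)%E; last first.
  by rewrite poweR_EFin -powRrM mulfV ?gt_eqF// powRr1// ltW.
rewrite muS inver gt_eqF//.
apply: gt0_ler_poweR; rewrite ?in_itv/= ?leey ?andbT.
- by rewrite invr_ge0 ltW.
- by rewrite mule_ge0 ?lee_fin ?invr_ge0 ?(ltW s0).
- by rewrite lee_fin powR_ge0.
by rewrite muleC lee_pdivrMr// -EFinM.
Qed.

(* Affine functions: if a unit-slope affine function is small at a point of the
   left and of the right part of one line, it is almost horizontal, and then its
   values on the two lines differ by almost the full gap. *)
Let far_segment p v : v != 0 -> exists c m, [/\ hline c `<=` E,
  hseg c m (r / 8) `<=` S &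
  forall y, hseg c m (r / 8) y ->
    eps * r / 8 <= dist_set y (line_through p v)].
Proof.
move=> v0; pose far c m := forall y, hseg c m (r / 8) y ->
    eps * r / 8 <= dist_set y (line_through p v).
have half s : s = 1 \/ s = -1 -> `|x.1 + s * (r / 2) - x.1| + r / 8 <= 3 * r / 4.
  move=> s1; rewrite addrAC subrr add0r.
  by case: s1 => ->; rewrite ?mul1r ?mulN1r ?normrN gtr0_norm ?divr_gt0//; lra_section.
have [fA|nA] := pselect (far c1 (x.1 + -1 * (r / 2))).
  exists c1; exists (x.1 + -1 * (r / 2)); split => //.
  by apply: hseg1_sub; apply: le_trans (half _ _) _; [right|lra_section].
have [fB|nB] := pselect (far c1 (x.1 + 1 * (r / 2))).
  exists c1; exists (x.1 + 1 * (r / 2)); split => //.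
  by apply: hseg1_sub; apply: le_trans (half _ _) _; [left|lra_section].
have [fC|nC] := pselect (far c2 (x.1 + -1 * (r / 2))).
  exists c2; exists (x.1 + -1 * (r / 2)); split => //.
  by apply: hseg2_sub; apply: half; right.
exfalso; have near c m : ~ far c m -> exists u, `|u - m| < r / 8 /\
    `|v.2 * (u - p.1) - v.1 * (c - p.2)| < eps * r / 8 * enorm v.
  move=> /existsNP[[u c']] /not_implyP[[/= -> um] /negP]; rewrite -ltNge => yV.
  exists u; split => //; rewrite -ltr_pdivrMr ?enorm_gt0//.
  by apply: le_lt_trans yV; exact: (@dist_set_line_ge _ p v (u, c)).
have [a [am aV]] := near _ _ nA; have [b [bm bV]] := near _ _ nB.
have [c [cm cV]] := near _ _ nC.
have n0 := enorm_gt0 _ v0; have := sqr_enorm v.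
move: am bm cm aV bV cV n0; move: (enorm v) v.1 v.2 p.1 p.2 x.1 => n v1 v2 p1 p2 x1.
rewrite !ltr_norml => /andP[a1 a2] /andP[b1 b2] /andP[c1' c2'].
move=> /andP[A1 A2] /andP[B1 B2] /andP[C1 C2] n0 nE.
(* The points [a] and [b] of the first line are at least [r - 2 * (r / 8)] apart, while the linear
   form varies by at most [eps * r * n / 4]. *)
have v2_small : `|v2| * (3 * r) <= eps * r * n.
  have ab : 3 * r / 4 <= b - a by lra_section.
  have : `|v2| * (b - a) <= eps * r * n / 4.
    by rewrite -[b - a]ger0_norm -?normrM ?ler_norml; [apply/andP; split|]; lra_section.
  have : `|v2| * (3 * r / 4) <= `|v2| * (b - a) by rewrite ler_wpM2l.
  lra_section.
have v2n : `|v2| <= n / 12.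
  have : `|v2| * (3 * r) <= n / 12 * (3 * r).
    by apply: le_trans v2_small _; have := ler_wpM2r (ltW n0) h4; lra_section.
  by rewrite ler_pM2r// mulr_gt0.
(* The points [a] and [c] lie on different lines, both near the left centre. The form then bounds
   [v1] times the gap by [1 / 4 + 1 / 12] of [eps * r * n]. *)
have v1n : `|v1| <= n / 2.
  have ca : `|c - a| <= r / 4 by rewrite ler_norml; apply/andP; split; lra_section.
  have : `|v1| * (eps * r) <= n / 2 * (eps * r).
    rewrite -gap -normrM.
    have -> : v1 * (c1 - c2) = (v2 * (c - p1) - v1 * (c2 - p2)) -
        (v2 * (a - p1) - v1 * (c1 - p2)) - v2 * (c - a) by ring.
    apply: le_trans (ler_normB _ _) _; rewrite [`|v2 * _|]normrM.
    have : `|v2| * `|c - a| <= `|v2| * (r / 4) by rewrite ler_wpM2l.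
    have : `|v2 * (c - p1) - v1 * (c2 - p2) - (v2 * (a - p1) - v1 * (c1 - p2))| <=
        eps * r * n / 4 by rewrite ler_norml; apply/andP; split; lra_section.
    rewrite gap; have := mulr_gt0 h0 n0; lra_section.
  by rewrite ler_pM2r.
(* Contradiction: [v1 ^+ 2 + v2 ^+ 2] equals [n ^+ 2] but is at most
   [(1 / 4 + 1 / 144) * n ^+ 2]. *)
have : v1 ^+ 2 <= (n / 2) ^+ 2.
  by rewrite -[leLHS]real_normK ?num_real// ler_sqr ?nnegrE// divr_ge0// ltW.
have : v2 ^+ 2 <= (n / 12) ^+ 2.
  by rewrite -[leLHS]real_normK ?num_real// ler_sqr ?nnegrE// divr_ge0// ltW.
have : 0 < n ^+ 2 by rewrite exprn_gt0.
lra_section.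
Qed.

Lemma beta_ge (q : R) : 1 <= q -> ((384^-1 * eps)%:E <= beta_coef E q S)%E.
Proof.
move=> q1; have [s /andP[s2 s4] muS] := mu_S.
have s0 : 0 < s by lra_section.
apply: le_ereal_inf_tmp => _ [_ [p [v v0 ->]] <-].
have [c [m [cE mS far]]] := far_segment p v v0.
(* [eps / 24] is the distance [eps * r / 8] over the maximal diameter [3 * r]; [16^-1] is the
   segment length [r / 4] over the maximal measure [4 * r]. *)
have -> : 384^-1 * eps = eps / 24 * 16^-1 * 1 `^ q^-1 by rewrite powR1; lra_section.
apply: root_ge => //; first by rewrite divr_ge0// ltW.
  by apply/andP; split; lra_section.
rewrite muS inver gt_eqF//.
rewrite [X in (_ <= X)%E]muleC lee_pdivlMr// -EFinM.
have /andP[d1 d3] := diam_S.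
have k0 := powR_ge0 (eps / 24) q.
have kr : (eps / 24) `^ q * (16^-1 * 1) * s <= (eps / 24) `^ q * (2 * (r / 8)).
  by rewrite -[leLHS]mulrA ler_wpM2l//; lra_section.
apply: (@le_trans _ _ ((eps / 24) `^ q * (2 * (r / 8)))%:E).
  by rewrite lee_fin.
rewrite EFinM -(hseg_mu c m) ?divr_ge0 ?(ltW r0)//.
apply: integral_ge_cst => //.
- by move=> y _; rewrite lee_fin powR_ge0.
- exact: hseg_measurable.
move=> y /far yV; rewrite lee_fin ge0_ler_powR ?nnegrE//.
- by rewrite (le_trans _ q1).
- by rewrite divr_ge0// ltW.
- by rewrite divr_ge0 ?(ltW diam_gt0)// (le_trans _ yV)// divr_ge0// ltW.
rewrite ler_pdivlMr//; apply: le_trans yV.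
by have := ler_wpM2l (ltW eps0) d3; lra_section.
Qed.

(** * The lower bound for [iota_coef] *)

(* The dyadic pieces of the second line seen from [y], on the side [s] where the
   increment [y - z] and the direction of [V] have opposite slopes, which makes
   the projection onto [V] contract at least as much as the horizontal one. *)
Let inner_ge (q : R) (N : nat) p v y : 1 <= q -> 2 ^+ N * eps <= 2^-1 ->
  v != 0 -> hseg c1 x.1 (r / 4) y ->
  ((N%:R * ((eps ^+ 2 / 18) `^ q * r))%:E <=
   \int[mu]_(z in S)
     (((`|enorm (y - z) - enorm (orth_proj (line_through p v) y -
                                 orth_proj (line_through p v) z)| / diam S)
       `^ q)%R)%:E)%E.
Proof.
move=> q1 N2 v0 [yc yx].
(* On side [s] the first coordinate of [y - z] has sign [- s] and the second is [c1 - c2], which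
   gives the sign condition of [orth_proj_defect_ge]. *)
pose s : R := if 0 <= v.1 * v.2 * (c1 - c2) then 1 else -1.
have s1 : s = 1 \/ s = -1 by rewrite /s; case: ifP; [left|right].
have sv : 0 <= s * (v.1 * v.2 * (c1 - c2)).
  by rewrite /s; case: ifPn; rewrite ?mul1r// -ltNge mulN1r oppr_ge0; apply: ltW.
pose t k : R := eps * r * 2 ^+ k.
have t0 k : 0 < t k by rewrite mulr_gt0 ?exprn_gt0.
(* Horizontal distances to [y] strictly between [t k] and [2 * t k], which is [t k.+1]. *)
pose Z (k : 'I_N) := hseg c2 (y.1 + s * (3 / 2 * t k)) (t k / 2).
have ZE k z : Z k z -> t k < s * (z.1 - y.1) < 2 * t k.
  move=> [_]; rewrite ltr_norml; have tk0 := t0 k.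
  by case: s1 => -> /andP[? ?]; apply/andP; split; lra.
have tS k : (k < N)%N -> t k.+1 <= r / 2.
  move=> kN; rewrite /t mulrAC mulrC ler_pM2l// mulrC; apply: le_trans N2.
  by rewrite ler_pM2r// ler_eXn2l ?ltr1n.
(* Horizontally [y] is within [r / 4] of [x], and the piece within [2 * t k <= r / 2] of [y]. *)
have ZS k : Z k `<=` S.
  apply: hseg2_sub; rewrite addrAC.
  apply: (@le_trans _ _ (`|y.1 - x.1| + `|s * (3 / 2 * t k)| + t k / 2)).
    by rewrite lerD2r ler_normD.
  have -> : `|s * (3 / 2 * t k)| = 3 / 2 * t k.
    by rewrite normrM [X in _ * X]gtr0_norm ?mulr_gt0//; case: s1 => ->;
      rewrite ?normrN1 ?normr1 mul1r.
  have := tS k (ltn_ord k); rewrite /t exprS.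
  by rewrite /t in t0 *; lra_section.
have disj (i j : 'I_N) z : Z i z -> Z j z -> i = j.
  move=> /ZE /andP[i1 i2] /ZE /andP[j1 j2]; apply/val_inj/eqP => /=.
  have lt2 a b : t a < 2 * t b -> (a <= b)%N.
    by rewrite /t mulrCA -exprS ltr_pM2l// ltr_eXn2l ?ltr1n.
  by rewrite eqn_leq (lt2 _ _ (lt_trans i1 j2)) (lt2 _ _ (lt_trans j1 i2)).
have /andP[d1 d3] := diam_S.
(* On [Z i] the defect is at least [(eps * r) ^+ 2 / (3 * (2 * t i))], and the diameter is at most
   [3 * r]. *)
pose k (i : 'I_N) : R := (eps / (18 * 2 ^+ i)) `^ q.
have le_sum : (\sum_(i < N) (k i)%:E * mu (Z i) <= \int[mu]_(z in S)
     (((`|enorm (y - z) - enorm (orth_proj (line_through p v) y -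
                                 orth_proj (line_through p v) z)| / diam S)
       `^ q)%R)%:E)%E.
  apply: integral_ge_sum => //.
  - by move=> z _; rewrite lee_fin powR_ge0.
  - by move=> i; exact: hseg_measurable.
  - by move=> i; exact: powR_ge0.
  move=> i z Zz; rewrite lee_fin ge0_ler_powR ?nnegrE//.
  - by rewrite (le_trans _ q1).
  - by rewrite divr_ge0 ?(ltW eps0)// mulr_ge0// exprn_ge0.
  - by rewrite divr_ge0// ltW.
  have /andP[z1 z2] := ZE _ _ Zz; have [zc _] := Zz.
  have w1 : `|(y - z).1| = s * (z.1 - y.1).
    have sz0 : 0 < s * (z.1 - y.1) by apply: lt_trans z1.
    by rewrite -(gtr0_norm sz0) normrM distrC; case: s1 => ->;
      rewrite ?normrN1 ?normr1 mul1r.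
  have w2 : (y - z).2 = c1 - c2 by rewrite /= yc zc.
  have tge : eps * r <= t i.
    by rewrite /t ler_pMr// exprn_ege1// ler1n.
  have := orth_proj_defect_ge p v y z v0; rewrite w1 w2 gap gap2.
  move=> defect; rewrite ler_pdivlMr//; apply: le_trans (defect _ _ _).
  - have szt : s * (z.1 - y.1) <= 2 * t i by apply: ltW.
    rewrite ler_pdivlMr; last by rewrite mulr_gt0//; apply: lt_trans z1.
    apply: (@le_trans _ _ (eps / (18 * 2 ^+ i) * (3 * r) * (3 * (2 * t i)))).
      have k0 : 0 <= eps / (18 * 2 ^+ i).
        by rewrite divr_ge0 ?(ltW eps0)// mulr_ge0// exprn_ge0.
      apply: ler_pM; [| |exact: ler_wpM2l|by rewrite ler_wpM2l].
        by rewrite mulr_ge0// ltW.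
      by rewrite mulr_ge0// (le_trans (ltW (t0 i)))// ltW.
    rewrite /t le_eqVlt; apply/orP; left; apply/eqP.
    by field; rewrite expf_neq0.
  - by apply: lt_trans z1.
  - by apply: le_trans tge (ltW z1).
  have -> : (y - z).1 = - s * (s * (z.1 - y.1)).
    by case: s1 => -> /=; lra.
  have : 0 <= s * (z.1 - y.1) * (s * (v.1 * v.2 * (c1 - c2))).
    by rewrite mulr_ge0// ltW// (lt_trans _ z1).
  lra.
apply: le_trans le_sum.
have -> : (N%:R * ((eps ^+ 2 / 18) `^ q * r))%:E =
    (\sum_(i < N) ((eps ^+ 2 / 18) `^ q * r)%:E)%E.
  by rewrite sumEFin sumr_const card_ord mulr_natl.
apply: lee_sum => i _.
rewrite /Z hseg_mu ?divr_ge0 ?(ltW (t0 i))// -EFinM lee_fin /k.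
(* The piece has length [a * r] and integrand at least [(eps ^+ 2 / 18 / a)]^ q[. As]a <= 1 <=
   q[, the factor]a^-1 [^ q] outweighs the short length, so every scale contributes equally. *)
pose a : R := 2 ^+ i * eps.
have a0 : 0 < a by rewrite mulr_gt0// exprn_gt0.
have a1 : a <= 1.
  have : a <= 2 ^+ N * eps by rewrite ler_pM2r// ler_eXn2l ?ltr1n// ltnW.
  lra.
have -> : eps / (18 * 2 ^+ i) = eps ^+ 2 / 18 * a^-1.
  by rewrite /a; field; rewrite expf_neq0// gt_eqF.
rewrite (@powRM _ _ a^-1) ?divr_ge0 ?sqr_ge0 ?invr_ge0 ?(ltW a0)//.
have -> : 2 * (t i / 2) = a * r by rewrite /t /a; field.
rewrite -[leRHS]mulrA ler_wpM2l ?powR_ge0// mulrA -[leLHS]mul1r ler_pM2r//.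
rewrite -ler_pdivrMr// mul1r -[leLHS]powRr1 ?invr_ge0 ?(ltW a0)//.
by apply: ler_powR => //; rewrite invf_ge1.
Qed.

Lemma iota_ge (q : R) : 1 <= q ->
  ((1728^-1 * (ln eps^-1 `^ q^-1) * eps ^+ 2)%:E <= iota_coef E q S)%E.
Proof.
move=> q1; have [s /andP[s2 s4] muS] := mu_S.
have s0 : 0 < s by lra_section.
have [N [N2 lnN]] := dyadic_scales eps eps_bounds.
have L0 : 0 <= ln eps^-1.
  by rewrite ln_ge0// invf_ge1//; move: eps4 => ?; lra_section.
apply: le_ereal_inf_tmp => _ [_ [p [v v0 ->]] <-].
(* Here 96 is 3 * 32: 3 from [dyadic_scales], 32 from comparing the outer segment of length [r / 2]
   with the squared measure, at most [16 * r ^+ 2]. *)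
have -> : 1728^-1 * (ln eps^-1 `^ q^-1) * eps ^+ 2 =
  eps ^+ 2 / 18 * 96^-1 * ln eps^-1 `^ q^-1 by lra.
apply: root_ge => //; first by rewrite divr_ge0// sqr_ge0.
  by apply/andP; split; lra.
set K := (eps ^+ 2 / 18) `^ q; have K0 : 0 <= K by exact: powR_ge0.
rewrite muS -EFin_expe inver gt_eqF ?exprn_gt0//.
rewrite [X in (_ <= X)%E]muleC lee_pdivlMr ?exprn_gt0// -EFinM.
apply: (@le_trans _ _ ((N%:R * (K * r)) * (2 * (r / 4)))%:E).
  rewrite lee_fin.
  have ss : s ^+ 2 <= 16 * r ^+ 2.
    have -> : 16 * r ^+ 2 = (4 * r) ^+ 2 by ring.
    by rewrite ler_sqr ?nnegrE ?(ltW s0)// mulr_ge0// ltW.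
  have -> : N%:R * (K * r) * (2 * (r / 4)) = K * (96^-1 * (3 * N%:R)) * (16 * r ^+ 2).
    by field.
  apply: ler_pM => //; [|exact: sqr_ge0|].
    by rewrite !mulr_ge0.
  by do 2 apply: ler_wpM2l => //.
rewrite EFinM -(hseg_mu c1 x.1) ?divr_ge0 ?(ltW r0)//.
apply: integral_ge_cst => //.
- by move=> y _; apply: integral_ge0 => z _; rewrite lee_fin powR_ge0.
- exact: hseg_measurable.
- by apply: hseg1_sub; rewrite subrr normr0 add0r; lra_section.
- by rewrite !mulr_ge0 ?ler0n// ltW.
by move=> y; exact: inner_ge.
Qed.

End two_lines.

(** * Reduction of the theorem to two horizontal lines *)

Section parallel_lines.
Context {R : realType}.
Implicit Types (l : set (R * R)).

Lemma parallel_horizontal_axis l : parallel l horizontal_axis ->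
  exists c, l = hline c.
Proof.
move=> [w wl]; exists (- w.2); apply/seteqP; split => y.
  move=> ly; have : horizontal_axis (w + y) by rewrite wl; exists y.
  by rewrite /horizontal_axis/hline/= => /eqP; rewrite addrC addr_eq0 => /eqP.
rewrite /hline/= => yw; have : horizontal_axis (w + y).
  by rewrite /horizontal_axis/= yw subrr.
by rewrite wl => -[z lz /addrI <-].
Qed.

Lemma set_dist_hline c : set_dist (hline c) horizontal_axis = `|c| :> R.
Proof.
have ne : [set enorm (y - z) | y in hline c & z in horizontal_axis]
    (enorm ((0, c) - (0, 0) : R * R)).
  by exists (0, c) => //; exists (0, 0).
apply/eqP; rewrite eq_le; apply/andP; split.
  rewrite -[leRHS](_ : enorm ((0, c) - (0, 0) : R * R) = _); last first.
    by rewrite enorm_vertical/= ?subr0.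
  by apply: ge_inf => //; exists 0 => _ [y _ [z _ <-]]; exact: enorm_ge0.
apply: lb_le_inf; first by eexists; exact: ne.
move=> _ [y yc [z z0 <-]]; apply: le_trans (norm_snd_le_enorm _).
by rewrite /= yc z0 subr0.
Qed.

End parallel_lines.

Theorem proposition3p12 (R : realType) :
  exists eps0 C : R, [/\ 0 < eps0 < 1, 1 <= C &
    forall (eps r : R), 0 < eps <= eps0 -> 0 < r ->
    forall l : set (R * R), affine_line l -> parallel l horizontal_axis ->
      set_dist l horizontal_axis = eps * r ->
    let E := horizontal_axis `|` l in
    forall q : R, 1 <= q -> forall x : R * R, E x ->
    let S := eball x r `&` E in
    ((C^-1 * eps)%:E <= beta_coef E (2 * q) S <= (C * eps)%:E)%E /\
    ((C^-1 * (ln eps^-1 `^ q^-1) * eps ^+ 2)%:E <= iota_coef E q S)%E].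
Proof.
(* 1728 comes from [iota_ge] and exceeds the 384 of [beta_ge]. *)
exists 4^-1; exists 1728; split; [by apply/andP; split; lra|lra|].
move=> eps r eps_bounds r0 l _ /parallel_horizontal_axis[c ->].
rewrite set_dist_hline => gap E q q1 x Ex S.
have eps0 : 0 < eps by case/andP: eps_bounds.
(* Taking [c1] as the height of the line through [x] treats both positions of [x] at once. *)
suff [c1 [c2 [gap12 xc EE]]] : exists c1 c2,
    [/\ `|c1 - c2| = eps * r, x.2 = c1 & E = hline c1 `|` hline c2].
  have q2 : 1 <= 2 * q by lra.
  rewrite /S EE; split; last exact: (iota_ge _ _ _ _ _ eps_bounds r0 gap12 xc _ q1).
  apply/andP; split.
    apply: le_trans (beta_ge _ _ _ _ _ eps_bounds r0 gap12 xc _ q2).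
    by rewrite lee_fin; apply: ler_wpM2r; [exact: ltW|lra].
  have q20 : 0 < 2 * q by lra.
  apply: le_trans (beta_le _ _ _ _ _ eps_bounds r0 gap12 xc _ q20) _.
  by rewrite lee_fin; lra.
case: Ex => xc; [exists 0; exists c|exists c; exists 0]; split => //.
- by rewrite sub0r normrN.
- by rewrite subr0.
- by rewrite /E setUC.
Qed.
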